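(* Let $\mathbf{p}=\mathbf{p}(n)=(p_{11},p_{10},p_{01},p_{00})$ be probability vectors depending on $n$ that satisfy $$\left(\sqrt{p_{11}p_{00}}-\sqrt{p_{01}p_{10}}\right)^2\ge\frac{2\log n+\omega(1)}{n},\qquad \frac{p_{01}p_{10}}{p_{11}p_{00}}<1 .$$ Let $(G_a,G_b)\sim ER(n,\mathbf{p})$, let $\Pi$ be a uniformly random permutation of $[n]$ independent of $(G_a,G_b)$, and let $G_c$ be the anonymization of $G_a$ by $\Pi$. Then there is an estimator for $\Pi$ given $(G_c,G_b)$ that is correct (i.e. equals $\Pi$) with probability $1-o(1)$.
   Context: $[n]=\{0,1,\dots,n-1\}$, and $\binom{[n]}{2}$ is the set of two-element subsets of $[n]$. A graph on $[n]$ is identified with its edge indicator function $g:\binom{[n]}{2}\to\{0,1\}$. $ER(n,\mathbf{p})$ is the distribution of a pair of graphs $(G_a,G_b)$ on $[n]$ such that the pairs $(G_a(e),G_b(e))$, $e\in\binom{[n]}{2}$, are i.i.d. and $(G_a(e),G_b(e))=(i,j)$ with probability $p_{ij}$ for $i,j\in\{0,1\}$ (entries of $\mathbf{p}$ nonnegative, summing to 1). The anonymization $G_c$ of $G_a$ by $\Pi$ is given by $G_c(\{\Pi(i),\Pi(j)\})=G_a(\{i,j\})$ for all $i\neq j$. An estimator for $\Pi$ given $(G_c,G_b)$ is a (possibly randomized) function of $(G_c,G_b)$ with values in the permutations of $[n]$. $\log$ is the natural logarithm; asymptotic notation is as $n\to\infty$, and $\omega(1)$ denotes a quantity tending to $+\infty$.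 *)

(* Defs.v *)
From mathcomp Require Import all_boot all_order all_algebra all_fingroup.
From mathcomp Require Import all_classical all_reals all_analysis.

Set Implicit Arguments.
Unset Strict Implicit.
Unset Printing Implicit Defensive.

Import Order.TTheory GRing.Theory Num.Theory.
Import numFieldNormedType.Exports.
Local Open Scope classical_set_scope.
Local Open Scope ring_scope.

Definition edge (n : nat) : Type := {e : {set 'I_n} | #|e| == 2}.

Definition graph (n : nat) : Type := {ffun edge n -> bool}.

Lemma card_pair_neq n (i j : 'I_n) : i != j -> #|[set i; j]%SET| == 2.
Proof. by move=> ij; rewrite cards2 ij. Qed.

Definition mkedge n (i j : 'I_n) (ij : i != j) : edge n :=
  exist _ [set i; j]%SET (card_pair_neq ij).

Lemma card_edge_image n (s : {perm 'I_n}) (e : edge n) :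
  #|[set s i | i in val e]%SET| == 2.
Proof. by rewrite card_imset ?(valP e) //; exact: perm_inj. Qed.

Definition edge_image n (s : {perm 'I_n}) (e : edge n) : edge n :=
  exist _ [set s i | i in val e]%SET (card_edge_image s e).

Definition anonymize n (s : {perm 'I_n}) (g : graph n) : graph n :=
  [ffun e => g (edge_image (s^-1)%g e)].

Lemma anonymizeE n (s : {perm 'I_n}) (g : graph n) (i j : 'I_n)
    (ij : i != j) (sij : s i != s j) :
  anonymize s g (mkedge sij) = g (mkedge ij).
Proof.
rewrite ffunE; congr (g _); apply: val_inj => /=.
by rewrite imsetU1 imset_set1 !permK.
Qed.

Section RandomVariables.
Context {d : measure_display} {T : measurableType d} {R : realType}.
Variable P : probability T R.

(* The finite codomain carries the discrete sigma-algebra. *)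
Definition discrete_rv (S : finType) (X : T -> S) : Prop :=
  forall x : S, measurable (X @^-1` [set x]).

Definition mutually_independent (I S : finType) (X : I -> T -> S) : Prop :=
  forall (J : {set I}) (A : I -> set S),
    P (\bigcap_(i in [set` J]) X i @^-1` A i)
    = (\prod_(i in J) P (X i @^-1` A i))%E.

Definition independent_rv (S1 S2 : Type) (X : T -> S1) (Y : T -> S2) : Prop :=
  forall (A : set S1) (B : set S2),
    P (X @^-1` A `&` Y @^-1` B) = (P (X @^-1` A) * P (Y @^-1` B))%E.

Definition uniform_rv (S : finType) (X : T -> S) : Prop :=
  discrete_rv X /\ forall x : S, P (X @^-1` [set x]) = (#|S|%:R^-1)%:E.

(* [p i j] is p_{ij}, with 1 = true and 0 = false. *)
Definition ER_pair (n : nat) (p : bool -> bool -> R)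
    (Ga Gb : T -> graph n) : Prop :=
  [/\ forall e, discrete_rv (fun w => (Ga w e, Gb w e)),
      mutually_independent (fun e w => (Ga w e, Gb w e))
    & forall e i j, P [set w | (Ga w e, Gb w e) = (i, j)] = (p i j)%:E].

End RandomVariables.

Definition probability_vector (R : realType) (p : bool -> bool -> R) : Prop :=
  (forall i j, 0 <= p i j) /\
  p true true + p true false + p false true + p false false = 1.

(* A randomized estimator: [est gc gb s] is the conditional probability that
   the output is [s] when the observed graphs are [gc] and [gb].  Deterministic
   estimators are the {0,1}-valued ones. *)
Record estimator (R : realType) (n : nat) := Estimator {
  est_prob :> graph n -> graph n -> {perm 'I_n} -> R;
  est_ge0 : forall gc gb s, 0 <= est_prob gc gb s;
  est_sum1 : forall gc gb, \sum_(s : {perm 'I_n}) est_prob gc gb s = 1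
}.

(* Probability that the output equals the hidden permutation, the internal
   randomness of the estimator being independent of it given the input. *)
Definition success_probability {d : measure_display} {T : measurableType d}
    {R : realType} (P : probability T R) (n : nat) (est : estimator R n)
    (Gc Gb : T -> graph n) (Pi : T -> {perm 'I_n}) : \bar R :=
  'E_P[fun w => est (Gc w) (Gb w) (Pi w)]%E.

(* Main.v *)
Require Import Defs.
From HB Require Import structures.
From mathcomp Require Import all_boot all_order all_algebra all_fingroup.
From mathcomp Require Import all_classical all_reals all_analysis.
From mathcomp Require Import ring lra zify.

Set Implicit Arguments.
Unset Strict Implicit.
Unset Printing Implicit Defensive.

Import Order.TTheory GRing.Theory Num.Theory.
Import numFieldNormedType.Exports.
Local Open Scope classical_set_scope.
Local Open Scope ring_scope.

(** The estimator is maximum likelihood.  With [L] the likelihood of a pair of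
graphs, a union bound and [L * 1{L' >= L} <= sqrt (L * L')] bound its error by
the sum over the vertex permutations [t != 1] of the Bhattacharyya coefficients
[\sum_(ga, gb) sqrt (L ga gb) * sqrt (L (ga \o t) gb)].  Summing [gb] out edge
by edge turns the coefficient into
[\sum_g \prod_e M (g e) (g (t e))] with [M = Q *m Q^T], [Q i j = sqrt (p i j)],
so that [\tr M = 1] and the squared Frobenius norm of [M] is [1 - 2 D], where
[D = (\det Q)^2] is the gap in the hypothesis.  Each edge fixed by [t] thus
costs [1] and each edge moved costs at most [sqrt (1 - 2 D) <= exp (- D)].
A permutation moving [m] vertices moves at least [m (n - 2) / 2] edges and there
are at most [n ^ m] of them, so the error is at most a geometric sum of ratio
[n * exp (- D (n - 2) / 2) <= exp (2 - omega / 6)]. *)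

(** * Sums of products along a permutation, bounded by eliminating one Boolean variable at a time *)

Lemma cauchy_schwarz2 (R : rcfType) (a a' b b' : R) :
  a * b + a' * b' <=
  Num.sqrt (a ^+ 2 + a' ^+ 2) * Num.sqrt (b ^+ 2 + b' ^+ 2).
Proof.
rewrite -sqrtrM; last by rewrite addr_ge0 ?sqr_ge0.
apply: (le_trans (ler_norm _)); rewrite -sqrtr_sqr ler_wsqrtr // -subr_ge0.
have -> : (a ^+ 2 + a' ^+ 2) * (b ^+ 2 + b' ^+ 2) - (a * b + a' * b') ^+ 2
          = (a * b' - a' * b) ^+ 2 by ring.
exact: sqr_ge0.
Qed.

Section PermutationSum.
Variables (R : rcfType) (V : finType) (t : V -> V) (M : bool -> bool -> R).
Hypothesis (t_inj : injective t) (M_ge0 : forall x y, 0 <= M x y).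
Implicit Types (A : {set V}) (g : {ffun V -> bool}) (u v : V) (x y : bool).

Definition flip v g : {ffun V -> bool} := [ffun u => g u (+) (u == v)].

Lemma flipK v : involutive (flip v).
Proof. by move=> g; apply/ffunP=> u; rewrite !ffunE -addbA addbb addbF. Qed.

Definition weight A u g x : R := ((u \in A) || (x == g u))%:R.

Lemma weight_ge0 A u g x : 0 <= weight A u g x.
Proof. exact: ler0n. Qed.

Lemma weight_other A u v g x :
  u != v -> weight (v |: A)%SET u g x = weight A u g x.
Proof. by rewrite /weight finset.in_setU1 => /negPf ->. Qed.

Lemma weight_flip A u v g x :
  u != v -> weight A u (flip v g) x = weight A u g x.
Proof. by rewrite /weight ffunE => /negPf ->; rewrite addbF. Qed.

Lemma weight_add A v g x : v \notin A ->
  weight A v g x + weight A v (flip v g) x = weight (v |: A)%SET v g x.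
Proof.
rewrite /weight finset.in_setU1 eqxx ffunE eqxx => /negPf -> /=.
by case: x; case: (g v); rewrite /= ?addr0 ?add0r.
Qed.

(* The factor of [u] after the variables of [A] have been eliminated: such a
   variable is summed over instead of being read off [g]. *)
Definition factor_sq A u g : R :=
  \sum_x \sum_y weight A u g x * weight A (t u) g y * M x y ^+ 2.

(** Interpolates between [M (g u) (g (t u))] at [A] empty and a trace or Frobenius norm at [A] full.
    A fixed [u] involves one variable, hence a diagonal sum; a moved [u] involves two, and the l2
    form is the one that Cauchy-Schwarz reproduces. *)
Definition factor A u g : R :=
  if t u == u then \sum_x weight A u g x * M x x
  else Num.sqrt (factor_sq A u g).

Lemma factor_sq_ge0 A u g : 0 <= factor_sq A u g.
Proof.
by do 2![apply: sumr_ge0 => ? _]; rewrite !mulr_ge0 ?weight_ge0 ?sqr_ge0.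
Qed.

Lemma factor_ge0 A u g : 0 <= factor A u g.
Proof.
rewrite /factor; case: ifP => _; last exact: sqrtr_ge0.
by apply: sumr_ge0 => x _; rewrite mulr_ge0 ?weight_ge0.
Qed.

Lemma factor_other A u v g :
  u != v -> t u != v -> factor (v |: A)%SET u g = factor A u g.
Proof.
move=> uv tuv; rewrite /factor /factor_sq; case: ifP => _.
  by apply: eq_bigr => x _; rewrite weight_other.
congr Num.sqrt; do 2![apply: eq_bigr => ? _]; by rewrite !weight_other.
Qed.

Lemma factor_flip A u v g :
  u != v -> t u != v -> factor A u (flip v g) = factor A u g.
Proof.
move=> uv tuv; rewrite /factor /factor_sq; case: ifP => _.
  by apply: eq_bigr => x _; rewrite weight_flip.
congr Num.sqrt; do 2![apply: eq_bigr => ? _]; by rewrite !weight_flip.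
Qed.

Lemma factor_add_fixed A v g : v \notin A -> t v = v ->
  factor A v g + factor A v (flip v g) = factor (v |: A)%SET v g.
Proof.
move=> vA tv; rewrite /factor tv eqxx -big_split /=; apply: eq_bigr => x _.
by rewrite -mulrDl weight_add.
Qed.

(** As [t u != u], exactly one of the two weights in [factor_sq] depends on [v], so the squares are
    additive in that variable. *)
Lemma factor_add_sqr A u v g :
  v \notin A -> t u != u -> (u == v) || (t u == v) ->
  Num.sqrt (factor A u g ^+ 2 + factor A u (flip v g) ^+ 2)
  = factor (v |: A)%SET u g.
Proof.
move=> vA tu uv; rewrite /factor (negPf tu) !sqr_sqrtr ?factor_sq_ge0 //.
congr Num.sqrt; rewrite /factor_sq -big_split /=; apply: eq_bigr => x _.
rewrite -big_split /=; apply: eq_bigr => y _.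
case: (eqVneq u v) uv tu => [-> _|uv /= /eqP tuv _].
  by move=> tv; rewrite (weight_flip _ _ _ tv) (weight_other _ _ _ tv)
    -!mulrDl weight_add.
rewrite tuv (weight_flip _ _ _ uv) (weight_other _ _ _ uv).
by rewrite -mulrDl -mulrDr weight_add.
Qed.


(* Cauchy-Schwarz in the variable [v]: since [t] is injective, [v] occurs in
   exactly two factors unless [t v = v]. *)
Lemma prod_factor_add A v g : v \notin A ->
  \prod_u factor A u g + \prod_u factor A u (flip v g)
  <= \prod_u factor (v |: A)%SET u g.
Proof.
move=> vA; case: (eqVneq (t v) v) => [tv | tv].
  rewrite (bigD1 v) // [X in _ + X](bigD1 v) // [leRHS](bigD1 v) //=.
  rewrite -factor_add_fixed // mulrDl le_eqVlt; apply/orP; left; apply/eqP.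
  congr (_ * _ + _ * _); apply: eq_bigr => u uv.
    by rewrite factor_other // -[in X in _ != X]tv (inj_eq t_inj).
  have tuv : t u != v by rewrite -[in X in _ != X]tv (inj_eq t_inj).
  by rewrite factor_other // factor_flip.
have /codomP[v' v'E] := injF_onto t_inj v.
have v'v : v' != v by apply: contra_neq tv => {1}<-.
have tv' : t v' != v' by rewrite -v'E eq_sym.
rewrite (bigD1 v) // (bigD1 v') // [X in _ + X](bigD1 v) //.
rewrite [X in _ + _ * X](bigD1 v') // [leRHS](bigD1 v) //=.
rewrite [X in _ <= _ * X](bigD1 v') //= !mulrA.
have rest w : (w != v) && (w != v') -> w != v /\ t w != v.
  by case/andP=> wv wv'; split=> //; rewrite v'E (inj_eq t_inj).
under [X in _ + _ * X]eq_bigr => w /rest[wv twv] do rewrite factor_flip //.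
under [X in _ <= _ * X]eq_bigr => w /rest[wv twv] do rewrite factor_other //.
rewrite -mulrDl ler_wpM2r //; first by apply: prodr_ge0 => u _; exact: factor_ge0.
rewrite -!factor_add_sqr ?eqxx -?v'E ?eqxx ?orbT //.
  exact: cauchy_schwarz2.
by rewrite eq_sym.
Qed.

(** The involution [flip v] turns twice the left sum into a sum over the pairs [g], [flip v g],
    whence the [2^-1]. *)
Lemma sum_prod_factor_add A v : v \notin A ->
  \sum_g \prod_u factor A u g <= 2^-1 * \sum_g \prod_u factor (v |: A)%SET u g.
Proof.
move=> vA; rewrite -(ler_pM2l (ltr0Sn R 1)) mulrA divff ?pnatr_eq0 // mul1r.
rewrite mulr_natl mulr2n {2}(reindex_inj (inv_inj (flipK v))) -big_split /=.
by apply: ler_sum => g _; exact: prod_factor_add.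
Qed.

Lemma sum_prod_factor_le A :
  \sum_g \prod_u factor finset.set0 u g
  <= 2^-1 ^+ #|A| * \sum_g \prod_u factor A u g.
Proof.
have [k] := ubnP #|A|; elim: k A => // k IH A.
have [-> _|[v vA]] := finset.set_0Vmem A; first by rewrite cards0 mul1r.
rewrite (cardsD1 v) vA ltnS => /IH/le_trans; apply.
rewrite exprSr -mulrA ler_wpM2l ?exprn_ge0 ?invr_ge0 ?ler0n //.
by rewrite -[in leRHS](finset.setD1K vA) sum_prod_factor_add // finset.setD11.
Qed.

(** Eliminating all variables leaves a product that does not depend on [g], and [2^-1 ^+ #|V|]
    cancels the number of functions [g]. *)
Lemma sum_prod_perm_le :
  \sum_(g : {ffun V -> bool}) \prod_u M (g u) (g (t u))
  <= \prod_u (if t u == u then \sum_x M x x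
              else Num.sqrt (\sum_x \sum_y M x y ^+ 2)).
Proof.
have w0 u g x : weight finset.set0 u g x = (x == g u)%:R by rewrite /weight finset.in_set0.
have wT u g x : weight [set: V]%SET u g x = 1 by rewrite /weight finset.in_setT.
have pick (F : bool -> R) b : \sum_x (x == b)%:R * F x = F b.
  rewrite (bigD1 b) //= eqxx mul1r big1 ?addr0 // => x /negPf ->.
  by rewrite mul0r.
have -> : \sum_(g : {ffun V -> bool}) \prod_u M (g u) (g (t u))
          = \sum_g \prod_u factor finset.set0 u g.
  apply: eq_bigr => g _; apply: eq_bigr => u _; rewrite /factor.
  case: eqP => [-> | _].
    by under eq_bigr do rewrite w0; rewrite pick.
  rewrite /factor_sq.
  under eq_bigr do under eq_bigr do rewrite !w0 -mulrA.
  under eq_bigr do rewrite -mulr_sumr pick.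
  by rewrite pick sqrtr_sqr ger0_norm.
apply: le_trans (sum_prod_factor_le [set: V]%SET) _.
have E g : \prod_u factor [set: V]%SET u g
           = \prod_u (if t u == u then \sum_x M x x
                      else Num.sqrt (\sum_x \sum_y M x y ^+ 2)).
  apply: eq_bigr => u _; rewrite /factor /factor_sq; case: ifP => _.
    by under eq_bigr do rewrite wT mul1r.
  by under eq_bigr do under eq_bigr do rewrite !wT !mul1r.
rewrite (eq_bigr _ (fun g _ => E g)).
rewrite sumr_const card_ffun card_bool cardsT -[X in _ * X]mulr_natl mulrA.
by rewrite natrX exprVn mulVf ?mul1r // expf_neq0 // pnatr_eq0.
Qed.

End PermutationSum.

(** * Counting moved vertices, moved edges and permutations *)

Definition moved n (s : {perm 'I_n}) : {set 'I_n} := [set i | s i != i]%SET.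

Definition moved_edges n (s : {perm 'I_n}) : {set edge n} :=
  [set e | edge_image s e != e]%SET.

Lemma edge_image_inj n (s : {perm 'I_n}) : injective (edge_image s).
Proof.
move=> e f /(congr1 val) /= /(imset_inj (@perm_inj _ s)) ef.
exact: val_inj.
Qed.

Lemma edge_imageM n (s t : {perm 'I_n}) (e : edge n) :
  edge_image (s * t)%g e = edge_image t (edge_image s e).
Proof.
apply: val_inj => /=; rewrite -imset_comp.
by apply: eq_imset => i /=; rewrite permM.
Qed.

(** For [j] other than [i] and [s i], the edge [{i, j}] moves, since its image contains [s i]. The
    value [j = s i] is left out because a swap of [i] and [s i] fixes that edge. *)
Lemma moved_edge_at n (s : {perm 'I_n}) (i : 'I_n) : s i != i ->
  (n - 2 <= #|[set e in moved_edges s | i \in val e]%SET|)%N.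
Proof.
move=> si.
pose J : {set 'I_n} := (~: [set i; s i])%SET.
have cJ : #|J| = (n - 2)%N by rewrite cardsCs finset.setCK cards2 eq_sym si card_ord.
have mk j : j \in J -> exists e, (e \in moved_edges s) && (val e == [set i; j]%SET).
  rewrite !inE negb_or => /andP[ji jsi].
  have ij : i != j by rewrite eq_sym.
  exists (mkedge ij); rewrite inE eqxx andbT.
  apply: contra_neq si => /(congr1 val) /= /setP/(_ (s i)).
  rewrite imset_f ?set21 // !inE => /esym/orP[/eqP //|/eqP sij].
  by rewrite sij eqxx in jsi.
have pair_inj : {in J &, injective (fun j => [set i; j]%SET)}.
  move=> j k; rewrite !inE !negb_or => /andP[ji _] _ /setP/(_ j).
  by rewrite !inE eqxx orbT (negPf ji) /= => /esym/eqP.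
rewrite -cJ -(card_in_imset pair_inj).
apply: leq_trans (leq_imset_card val _).
apply/subset_leq_card/fintype.subsetP => A /imsetP[j /mk[e /andP[eM /eqP eE]] ->].
by apply/imsetP; exists e; rewrite // finset.inE eM eE set21.
Qed.

(** Double counting of incidences between moved vertices and moved edges: an edge has two ends. *)
Lemma card_moved_edges n (s : {perm 'I_n}) :
  (#|moved s| * (n - 2) <= 2 * #|moved_edges s|)%N.
Proof.
apply: (@leq_trans (\sum_(i in moved s) #|[set e in moved_edges s | i \in val e]%SET|)).
  rewrite -sum_nat_const; apply: leq_sum => i.
  by rewrite inE; exact: moved_edge_at.
under eq_bigr do rewrite -sum1_card big_mkcond /=.
rewrite exchange_big /=.
rewrite mulnC -sum_nat_const [leqRHS]big_mkcond /=.
apply: leq_sum => e _.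
case: (boolP (e \in moved_edges s)) => eM; last first.
  rewrite big1 // => i _; case: ifP => //; rewrite finset.inE => /andP[eM' _].
  by case/negP: eM.
apply: (@leq_trans #|val e|); last by rewrite (eqP (valP e)).
rewrite -sum1_card [leqLHS]big_mkcond [leqRHS]big_mkcond.
apply: leq_sum => i _; case: ifP => // _.
by case: ifP => //; rewrite finset.inE => /andP[_ ->].
Qed.

(** Such a permutation lives on some [m]-subset, which leaves at most ['C(n, m) * m!] choices, a
    falling factorial. *)
Lemma card_perm_moved n m :
  (#|[set s : {perm 'I_n} | #|moved s| == m]%SET| <= n ^ m)%N.
Proof.
apply: (@leq_trans
  (\sum_(s : {perm 'I_n}) \sum_(S : {set 'I_n} | #|S| == m) perm_on S s)).
  rewrite -sum1_card big_mkcond; apply: leq_sum => s _; case: ifP => //.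
  rewrite finset.inE => sm; rewrite (bigD1 (moved s)) //=.
  suff -> : perm_on (moved s) s by [].
  by apply/fintype.subsetP => i; rewrite !inE.
rewrite exchange_big /=.
have E (S : {set 'I_n}) : #|S| == m ->
    (\sum_(s : {perm 'I_n}) perm_on S s)%N = m`!.
  by move=> /eqP <-; rewrite -card_perm -sum1_card [RHS]big_mkcond.
rewrite (eq_bigr _ E).
rewrite sum_nat_const -cardsE card_draws card_ord bin_ffact.
elim: m {E} => [|m IH]; first by rewrite ffactn0.
by rewrite ffactnSr expnSr leq_mul // leq_subr.
Qed.

(** * Likelihoods, Bhattacharyya coefficients and the maximum likelihood rule *)

Section Likelihood.
Variables (R : realType) (n : nat) (p : bool -> bool -> R).
Hypothesis p_prob : probability_vector p.
Implicit Types (s t : {perm 'I_n}) (ga gb : graph n).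

Let p_ge0 i j : 0 <= p i j. Proof. by case: p_prob. Qed.

Definition likelihood ga gb : R := \prod_e p (ga e) (gb e).

Lemma likelihood_ge0 ga gb : 0 <= likelihood ga gb.
Proof. exact: prodr_ge0. Qed.

Lemma sqrt_likelihood ga gb :
  Num.sqrt (likelihood ga gb) = \prod_e Num.sqrt (p (ga e) (gb e)).
Proof.
rewrite /likelihood.
apply: (@proj2 (0 <= \prod_e p (ga e) (gb e))).
elim/big_rec2: _ => [|e x y _ [y0 yx]]; first by rewrite sqrtr1 ler01.
by rewrite sqrtrM ?mulr_ge0 // yx.
Qed.

Definition affinity s : R :=
  \sum_ga \sum_gb Num.sqrt (likelihood ga gb)
    * Num.sqrt (likelihood (anonymize s^-1 ga) gb).

Definition gap : R :=
  (Num.sqrt (p true true * p false false)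
   - Num.sqrt (p false true * p true false)) ^+ 2.

Definition kernel_mx (x y : bool) : R :=
  \sum_b Num.sqrt (p x b) * Num.sqrt (p y b).

Lemma kernel_mx_ge0 x y : 0 <= kernel_mx x y.
Proof. by apply: sumr_ge0 => b _; rewrite mulr_ge0 ?sqrtr_ge0. Qed.

Lemma kernel_mx_trace : \sum_x kernel_mx x x = 1.
Proof.
rewrite big_bool /kernel_mx !big_bool /= -!expr2 !sqr_sqrtr //.
by case: p_prob => _ <-; ring.
Qed.

(** A symmetric 2 by 2 matrix [M] has squared Frobenius norm [(\tr M)^2 - 2 * \det M], and here
    [\det M] is the square of [\det Q]. *)
Lemma kernel_mx_frobenius : \sum_x \sum_y kernel_mx x y ^+ 2 = 1 - 2 * gap.
Proof.
rewrite /gap /kernel_mx !sqrtrM // !big_bool.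
set a := Num.sqrt (p true true); set b := Num.sqrt (p true false).
set c := Num.sqrt (p false true); set e := Num.sqrt (p false false).
have sum1 : a ^+ 2 + b ^+ 2 + c ^+ 2 + e ^+ 2 = 1.
  by rewrite !sqr_sqrtr //; case: p_prob.
(* The constant [1] is replaced by the square of the total mass, so that both sides are homogeneous
   quartics. *)
transitivity ((a ^+ 2 + b ^+ 2 + c ^+ 2 + e ^+ 2) ^+ 2
              - 2 * (a * e - c * b) ^+ 2); last by rewrite sum1 expr1n.
by rewrite -/a -/b -/c -/e /=; ring.
Qed.

Lemma affinityE s :
  affinity s = \sum_(g : {ffun edge n -> bool})
    \prod_e kernel_mx (g e) (g (edge_image s e)).
Proof.
apply: eq_bigr => ga _; rewrite [RHS]bigA_distr_bigA; apply: eq_bigr => gb _.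
rewrite !sqrt_likelihood -big_split; apply: eq_bigr => e _ /=.
by rewrite ffunE invgK.
Qed.

Lemma affinity_le s : affinity s <= expR (- gap) ^+ #|moved_edges s|.
Proof.
rewrite affinityE.
apply: le_trans (sum_prod_perm_le (@edge_image_inj n s) kernel_mx_ge0) _.
rewrite kernel_mx_trace kernel_mx_frobenius -prodr_const [leRHS]big_mkcond.
apply: ler_prod => e _; rewrite finset.inE.
case: ifP => _ /=; first by rewrite ler01 lexx.
(* Comparison of squares: [1 - 2 * gap <= expR (- 2 * gap)], an instance of [1 + x <= expR x]. *)
rewrite sqrtr_ge0 -[leRHS](ger0_norm (expR_ge0 _)) -sqrtr_sqr.
rewrite ler_wsqrtr // -expRM_natl.
by apply: le_trans (expR_ge1Dx _) => //; rewrite mulrN.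
Qed.

(** Under a uniform prior this is also the maximum a posteriori choice; [1%g] is the inhabitant that
    [arg max] asks for. *)
Definition ml_perm ga gb : {perm 'I_n} :=
  [arg max_(s > 1%g) likelihood (anonymize s^-1 ga) gb]%O.

Lemma ml_perm_max ga gb s :
  likelihood (anonymize s^-1 ga) gb
  <= likelihood (anonymize (ml_perm ga gb)^-1 ga) gb.
Proof. by rewrite /ml_perm; case: arg_maxP => // t _; apply. Qed.

Lemma anonymizeM s t ga :
  anonymize t (anonymize s ga) = anonymize (s * t)%g ga.
Proof. by apply/ffunP=> e; rewrite !ffunE invMg edge_imageM. Qed.

Lemma anonymizeK s ga : anonymize s^-1 (anonymize s ga) = ga.
Proof.
rewrite anonymizeM mulgV; apply/ffunP=> e; rewrite ffunE invg1; congr (ga _).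
apply: val_inj => /=; rewrite -[RHS]imset_id.
by apply: eq_imset => i; rewrite perm1.
Qed.

Lemma ml_perm_error s :
  \sum_ga \sum_gb likelihood ga gb * (ml_perm (anonymize s ga) gb != s)%:R
  <= \sum_(t | t != 1%g) affinity t.
Proof.
rewrite /affinity [leRHS]exchange_big /=; apply: ler_sum => ga _.
rewrite [leRHS]exchange_big /=; apply: ler_sum => gb _.
have ge0 t : 0 <= Num.sqrt (likelihood ga gb)
    * Num.sqrt (likelihood (anonymize t^-1 ga) gb).
  by rewrite mulr_ge0 ?sqrtr_ge0.
case: (eqVneq (ml_perm _ _) s) => [_|ms].
  by rewrite mulr0; apply: sumr_ge0.
rewrite mulr1; set m := ml_perm _ _ in ms *.
(* The competitor is [t = m * s^-1]: decoding with [m] a graph anonymized by [s] yields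
   [anonymize t^-1 ga], and [t != 1] since [m != s]. *)
rewrite (bigD1 (m * s^-1)%g) /=; last by rewrite -eq_mulgV1.
apply: ler_wpDr; first exact: sumr_ge0.
have := ml_perm_max (anonymize s ga) gb s.
rewrite anonymizeK -/m anonymizeM invMg invgK => le_m.
by rewrite -[leLHS]sqr_sqrtr ?likelihood_ge0 // expr2 ler_wpM2l ?sqrtr_ge0 ?ler_wsqrtr.
Qed.

End Likelihood.

(** * From the probability space to finite sums of likelihoods *)

Section FiniteRandomVariables.
Context {d : measure_display} {T : measurableType d} {R : realType}.
Variable P : probability T R.

(** The event is a finite union of fibres; subadditivity suffices because the error event is only
    bounded from above. *)
Lemma discrete_rv_pred (S : finType) (X : T -> S) (B : pred S) :
  discrete_rv X ->
  measurable [set w | B (X w)] /\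
  (P [set w | B (X w)] <= \sum_(x | B x) P (X @^-1` [set x]))%E.
Proof.
move=> mX.
have -> : [set w | B (X w)] = \big[setU/set0]_(x | B x) X @^-1` [set x].
  rewrite -bigcup_seq_cond; apply/seteqP; split=> w /=.
    by move=> Bw; exists (X w) => //=; rewrite mem_index_enum.
  by move=> [x /= /andP[_ Bx] ->].
apply: (big_ind2 (fun A v => measurable A /\ (P A <= v)%E)).
- by rewrite measure0.
- move=> A u B' v [mA Au] [mB Bv]; split; first exact: measurableU.
  by apply: le_trans (measureU2 _ mA mB) _; exact: leeD.
- by move=> x _; split.
Qed.

Variables (n : nat) (p : bool -> bool -> R).
Variables (Ga Gb : T -> graph n) (Pi : T -> {perm 'I_n}).
Hypothesis GaGb_ER : ER_pair P p Ga Gb.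

Lemma ER_pair_preimage ga gb :
  (fun w => (Ga w, Gb w)) @^-1` [set (ga, gb)]
  = \bigcap_(e in [set` [set: edge n]%SET])
      (fun w => (Ga w e, Gb w e)) @^-1` [set (ga e, gb e)].
Proof.
apply/seteqP; split=> w /=; first by case=> <- <-.
by move=> E; congr (_, _); apply/ffunP => e;
  have [] := E e (finset.in_setT e).
Qed.

Lemma ER_pair_discrete : discrete_rv (fun w => (Ga w, Gb w)).
Proof.
move=> [ga gb]; rewrite ER_pair_preimage.
apply: fin_bigcap_measurable => [|e _]; first exact: finite_finpred.
by case: GaGb_ER => m _ _; exact: m.
Qed.

Lemma ER_pair_law ga gb :
  P ((fun w => (Ga w, Gb w)) @^-1` [set (ga, gb)]) = (likelihood p ga gb)%:E.
Proof.
case: GaGb_ER => _ indep law; rewrite ER_pair_preimage.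
rewrite (indep [set: edge n]%SET (fun e => [set (ga e, gb e)])).
rewrite /likelihood -prodEFin big_mkcond /=.
by apply: eq_bigr => e _; rewrite finset.in_setT -(law e (ga e) (gb e)).
Qed.

Hypothesis Pi_uniform : uniform_rv P Pi.
Hypothesis Pi_indep : independent_rv P Pi (fun w => (Ga w, Gb w)).

Let X w : {perm 'I_n} * (graph n * graph n) := (Pi w, (Ga w, Gb w)).

Let X_preimage s g : X @^-1` [set (s, g)]
  = Pi @^-1` [set s] `&` (fun w => (Ga w, Gb w)) @^-1` [set g].
Proof. by apply/seteqP; rewrite /X; split=> w /= [<- <-]. Qed.

Let X_discrete : discrete_rv X.
Proof.
move=> [s g]; rewrite X_preimage; apply: measurableI.
  by case: Pi_uniform => m _; exact: m.
exact: ER_pair_discrete.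
Qed.

Let X_law s ga gb : P (X @^-1` [set (s, (ga, gb))])
  = (#|{perm 'I_n}|%:R^-1 * likelihood p ga gb)%:E.
Proof.
rewrite X_preimage Pi_indep ER_pair_law EFinM.
by case: Pi_uniform => _ ->.
Qed.

(** Kept transparent so that its success probability unfolds to the expectation of an indicator. *)
Definition ml_estimator : estimator R n.
Proof.
apply: (@Estimator R n (fun gc gb s => (s == ml_perm p gc gb)%:R)).
- by move=> *; exact: ler0n.
- move=> gc gb; rewrite (bigD1 (ml_perm p gc gb)) //= eqxx big1 ?addr0 //.
  by move=> s /negPf ->.
Defined.

Hypothesis p_prob : probability_vector p.

Lemma ml_estimator_success :
  ((1 - \sum_(t : {perm 'I_n} | t != 1%g) affinity p t)%:E
   <= success_probability P ml_estimator
        (fun w => anonymize (Pi w) (Ga w)) Gb Pi <= 1)%E.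
Proof.
pose B (x : {perm 'I_n} * (graph n * graph n)) :=
  ml_perm p (anonymize x.1 x.2.1) x.2.2 != x.1.
have [mB PB] := discrete_rv_pred B X_discrete.
set F := [set w | B (X w)] in mB PB.
have -> : success_probability P ml_estimator
    (fun w => anonymize (Pi w) (Ga w)) Gb Pi = P (~` F).
  rewrite -expectation_indic; last exact: measurableC.
  congr expectation; apply/funext => w; rewrite indicE /=; congr (_%:R).
  rewrite /F /B /X; case: (eqVneq (ml_perm _ _ _) _) => E.
    by rewrite mem_set //= E eqxx.
  by rewrite memNset //=; apply.
rewrite probability_le1 ?andbT; last exact: measurableC.
rewrite probability_setC // EFinB leeB // (le_trans PB) //.
rewrite (eq_bigr (fun x => (#|{perm 'I_n}|%:R^-1 * likelihood p x.2.1 x.2.2)%:E)); last first.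
  by move=> [s [ga gb]] _; exact: X_law.
rewrite sumEFin lee_fin.
pose E (s : {perm 'I_n}) (ga gb : graph n) := #|{perm 'I_n}|%:R^-1 *
  (likelihood p ga gb * (ml_perm p (anonymize s ga) gb != s)%:R).
have -> : \sum_(x | B x) #|{perm 'I_n}|%:R^-1 * likelihood p x.2.1 x.2.2
  = \sum_(s : {perm 'I_n}) \sum_(ga : graph n) \sum_(gb : graph n) E s ga gb.
  under [RHS]eq_bigr do rewrite pair_big /=.
  rewrite pair_big /= big_mkcond /=; apply: eq_bigr => -[s [ga gb]] _ /=.
  by rewrite /E /B /=; case: ifP => _; rewrite ?mulr1 ?mulr0.
set A := \sum_(t : {perm 'I_n} | t != 1%g) affinity p t.
(* The error bound is the same for every hidden [s], so averaging over the uniform law leaves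
   [A]. *)
apply: (@le_trans _ _ (\sum_(s : {perm 'I_n}) #|{perm 'I_n}|%:R^-1 * A)).
  apply: ler_sum => s _.
  under eq_bigr do rewrite -mulr_sumr.
  by rewrite -mulr_sumr ler_wpM2l ?invr_ge0 ?ler0n //; exact: ml_perm_error.
rewrite sumr_const -[leLHS]mulr_natl mulrA divff ?mul1r //.
by rewrite pnatr_eq0 -lt0n; apply/card_gt0P; exists 1%g.
Qed.

End FiniteRandomVariables.

(** * Summation over permutations and the limit *)

Lemma sum_geometric_le (R : realFieldType) (r : R) k :
  0 <= r -> r <= 1 / 2 -> \sum_(i < k) r ^+ i.+1 <= 2 * r.
Proof.
(* The added remainder makes the induction close: [2 * r ^+ k.+2 <= r ^+ k.+1] as [r <= 1 / 2]. *)
move=> r0 r2; suff: \sum_(i < k) r ^+ i.+1 + 2 * r ^+ k.+1 <= 2 * r.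
  by apply: le_trans; rewrite lerDl mulr_ge0 // exprn_ge0.
elim: k => [|k IH]; first by rewrite big_ord0 add0r expr1.
apply: le_trans IH; rewrite big_ord_recr /= -addrA lerD2l [r ^+ k.+2]exprS.
have : 0 <= r ^+ k.+1 by rewrite exprn_ge0.
by nra.
Qed.

(** Grouping by the number [m = i.+1] of moved points, positive as [s != 1], gives at most [n ^ m]
    terms [q ^+ m], hence a geometric series of ratio [n * q]. *)
Lemma sum_perm_moved_le (R : realFieldType) n (q : R) :
  0 <= q -> n%:R * q <= 1 / 2 ->
  \sum_(s : {perm 'I_n} | s != 1%g) q ^+ #|moved s| <= 2 * (n%:R * q).
Proof.
move=> q0 nq; have nq0 : 0 <= n%:R * q by rewrite mulr_ge0.
apply: le_trans (sum_geometric_le n nq0 nq).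
apply: (@le_trans _ _ (\sum_(s : {perm 'I_n})
    \sum_(i < n | #|moved s| == i.+1) q ^+ i.+1)).
  rewrite big_mkcond; apply: ler_sum => s _; case: ifP => [s1|_]; last first.
    by apply: sumr_ge0 => i _; rewrite exprn_ge0.
  have m0 : (0 < #|moved s|)%N.
    rewrite lt0n; apply: contraNneq s1 => /eqP; rewrite cards_eq0 => /eqP m0.
    apply/eqP/permP => i; rewrite perm1; apply/eqP/negPn/negP => si.
    have : i \in moved s by rewrite finset.inE.
    by rewrite m0 finset.in_set0.
  have mn : (#|moved s|.-1 < n)%N.
    by rewrite prednK // -[leqRHS]card_ord max_card.
  rewrite (bigD1 (Ordinal mn)) /= prednK // lerDl.
  by apply: sumr_ge0 => i _; rewrite exprn_ge0.
rewrite (exchange_big_dep predT) //=; apply: ler_sum => i _.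
rewrite sumr_const -[leLHS]mulr_natl exprMn -natrX.
rewrite ler_wpM2r ?exprn_ge0 // ler_nat.
by apply: leq_trans (card_perm_moved n i.+1); rewrite cardsE.
Qed.

Lemma sum_affinity_le (R : realType) n (p : bool -> bool -> R) (w : R) :
  probability_vector p -> (2 < n)%N -> 0 <= w ->
  (2 * ln n%:R + w) / n%:R <= gap p -> expR (2 - w / 6) <= 1 / 2 ->
  \sum_(s : {perm 'I_n} | s != 1%g) affinity p s <= 2 * expR (2 - w / 6).
Proof.
move=> p_prob n2 w0 le_gap small.
(* Moving [m] vertices moves at least [m * (n - 2) / 2] edges, so each affinity is at most
   [q ^+ m]. *)
set q := expR (- (gap p * (n%:R - 2) / 2)).
have n0 : 0 < n%:R :> R by rewrite ltr0n; lia.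
have n3 : 3 <= n%:R :> R by rewrite (ler_nat _ 3).
have gap0 : 0 <= gap p := sqr_ge0 _.
have nq : n%:R * q <= expR (2 - w / 6).
  rewrite -[X in X * q]lnK ?posrE // -expRD ler_expR.
  have lnn := ltW (ln_sublinear n0).
  have ln0 : 0 <= ln n%:R :> R by apply: ln_ge0; lra.
  have : (2 * ln n%:R + w) / n%:R * (n%:R - 2) / 2 <= gap p * (n%:R - 2) / 2.
    by rewrite ler_wpM2r ?invr_ge0 // ler_wpM2r // subr_ge0; lra.
  (* The leading [ln n] cancels the factor [n]. The losses are at most [2], by [ln n <= n], and
     [w / 3], by [3 <= n], so [w / 6] remains of the gain [w / 2]. *)
  have -> : (2 * ln n%:R + w) / n%:R * (n%:R - 2) / 2
    = ln n%:R + w / 2 - 2 * (ln n%:R / n%:R) - w * n%:R^-1.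
    by field; rewrite gt_eqF.
  have : ln n%:R / n%:R <= 1 :> R by rewrite ler_pdivrMr // mul1r.
  have : w * n%:R^-1 <= w / 3 by rewrite ler_wpM2l // lef_pV2 ?posrE //; lra.
  by lra.
have nq2 : n%:R * q <= 1 / 2 := le_trans nq small.
have q0 : 0 <= q := expR_ge0 _.
apply: (@le_trans _ _ (2 * (n%:R * q))); last by rewrite ler_wpM2l.
apply: le_trans (sum_perm_moved_le q0 nq2).
apply: ler_sum => s _; apply: le_trans (affinity_le p_prob s) _.
rewrite /q -!expRM_natl ler_expR !mulrN lerN2.
have := card_moved_edges s.
rewrite -(ler_nat R) !natrM natrB; last by lia.
move=> /(ler_wpM2l gap0); by lra.
Qed.

Theorem theorem3 (R : realType) (p : nat -> bool -> bool -> R)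
    (p_prob : forall n, probability_vector (p n))
    (omega : nat -> R) (omega_oo : omega n @[n --> \oo] --> +oo)
    (p_gap : \forall n \near \oo,
      (Num.sqrt (p n true true * p n false false)
       - Num.sqrt (p n false true * p n true false)) ^+ 2
      >= (2 * ln n%:R + omega n) / n%:R)
    (p_ratio : \forall n \near \oo,
      p n true true * p n false false != 0 /\
      (p n false true * p n true false) / (p n true true * p n false false) < 1)
    (d : nat -> measure_display) (T : forall n, measurableType (d n))
    (P : forall n, probability (T n) R)
    (Ga Gb : forall n, T n -> graph n) (Pi : forall n, T n -> {perm 'I_n})
    (GaGb_ER : forall n, ER_pair (P n) (p n) (Ga n) (Gb n))
    (Pi_uniform : forall n, uniform_rv (P n) (Pi n))
    (Pi_indep : forall n,
      independent_rv (P n) (Pi n) (fun w => (Ga n w, Gb n w))) :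
  exists est : forall n, estimator R n,
    success_probability (P n) (est n)
      (fun w => anonymize (Pi n w) (Ga n w)) (Gb n) (Pi n)
    @[n --> \oo] --> 1%E.
Proof.
exists (fun n => ml_estimator n (p n)).
have err0 : expR (2 - omega n / 6) @[n --> \oo] --> (0 : R).
  have lim : omega n / 6 - 2 @[n --> \oo] --> +oo.
    apply/cvgryPge => A; have /cvgryPge/(_ ((A + 2) * 6)) := omega_oo.
    by apply: filterS => n ?; rewrite lerBrDr ler_pdivlMr.
  rewrite (_ : (fun n => _) = (fun x => expR (- x)) \o (fun n => omega n / 6 - 2)).
    exact: cvg_comp lim (@cvgr_expR R).
  by apply/funext => n /=; rewrite opprB.
have lower : (1 - 2 * expR (2 - omega n / 6))%:E @[n --> \oo] --> 1%E.
  apply/fine_cvgP; split; first exact: nearW.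
  have err2 : 2 * expR (2 - omega n / 6) @[n --> \oo] --> (2 * 0 : R).
    exact: cvgM (cvg_cst _) err0.
  have : 1 - 2 * expR (2 - omega n / 6) @[n --> \oo] --> (1 - 2 * 0 : R).
    exact: cvgB (cvg_cst _) err2.
  by rewrite mulr0 subr0.
(* For large [n] one has [2 < n], [0 <= omega n], the gap bound and
   [expR (2 - omega n / 6) <= 1 / 2], which puts the success probability between [lower] and [1]. *)
apply: (squeeze_cvge _ lower (cvg_cst _)).
near=> n.
have /andP[success ->] := ml_estimator_success (GaGb_ER n) (Pi_uniform n)
  (@Pi_indep n) (p_prob n).
rewrite andbT; apply: le_trans success; rewrite lee_fin lerB //.
apply: sum_affinity_le => //.
- by near: n; exists 3%N.
- by near: n; have /cvgryPge := omega_oo; apply.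
- by near: n.
- by near: n; apply: (cvgr_le _ err0); rewrite divr_gt0.
Unshelve. all: by end_near.
Qed.
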